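(* Let $k\ge 2$ be an even integer and $n\ge 1$ an odd integer. Then $a_k(n)$ satisfies the triangular number recurrence relation $$a_k(n)=\sum_{j\ge 1}(-1)^{\frac{j(j+1)}{2}+1}\,a_k\!\left(n-\tfrac{j(j+1)}{2}\right),$$ that is, $a_k(n)=a_k(n-1)+a_k(n-3)-a_k(n-6)-a_k(n-10)+a_k(n-15)+a_k(n-21)-a_k(n-28)-a_k(n-36)+\cdots$.
   Context: For integers $n\ge 0$ and $k\ge 2$, $a_k(n)$ is the total number of parts divisible by $k$, counted with multiplicity, in all partitions of $n$ in which every part has multiplicity strictly less than $k$. (Writing a partition as $(\lambda_1^{m_1},\ldots,\lambda_\ell^{m_\ell})$ with distinct positive integer parts $\lambda_i$ of multiplicity $m_i\ge1$ and $\sum_i m_i\lambda_i=n$, $a_k(n)$ is the sum over all partitions of $n$ with all $m_i<k$ of $\sum_{i:\,k\mid\lambda_i} m_i$.) By convention $a_k(r)=0$ for $r<0$, so the sum is finite. *)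

(* Defs.v *)
From HB Require Import structures.
From mathcomp Require Import all_boot all_order all_algebra.

Set Implicit Arguments.
Unset Strict Implicit.
Unset Printing Implicit Defensive.

(* A partition of n is encoded by its multiplicities: [m i] is the number of  *)
(* occurrences of the part i.+1 (0 when i.+1 is not a part). Parts of a       *)
(* partition of n are at most n, and so are their multiplicities.             *)
Definition is_partition (n : nat) (m : {ffun 'I_n -> 'I_n.+1}) : bool :=
  (\sum_(i < n) m i * i.+1 == n)%N.

Definition mult_lt (k n : nat) (m : {ffun 'I_n -> 'I_n.+1}) : bool :=
  [forall i, (m i < k)%N].

Definition num_parts_dvd (k n : nat) (m : {ffun 'I_n -> 'I_n.+1}) : nat :=
  (\sum_(i < n | k %| i.+1) m i)%N.

Definition a_nat (k n : nat) : nat :=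
  (\sum_(m : {ffun 'I_n -> 'I_n.+1} | is_partition m && mult_lt k m)
     num_parts_dvd k m)%N.

Definition a (k : nat) (r : int) : int :=
  match r with
  | Posz n => Posz (a_nat k n)
  | Negz _ => 0%R
  end.

Definition triangular (j : nat) : nat := ((j * (j + 1)) %/ 2)%N.

(* Main.v *)
Require Import Defs.
From HB Require Import structures.
From mathcomp Require Import all_boot all_order all_algebra.
From mathcomp Require Import zify ring.

Set Implicit Arguments.
Unset Strict Implicit.

Import GRing.Theory.
Local Open Scope ring_scope.

(** Write P(q) for the product of the (1 - q^i), and A(q) for the generating
    function of a_k. Marking one part divisible by k gives
      A(q) P(q) = sum over i divisible by k of
                    (1 - q^i) (sum_(j < k) j q^(i j))
                    * prod_(l <> i) (1 - q^(k l)),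
    because (1 - q^l) (1 + q^l + ... + q^((k-1) l)) = 1 - q^(k l). For even k
    every exponent on the right is even, so A P is a series in q^2
    ([parts_gf_even]).

    Let psi(q) be the sum of the q^(j(j+1)/2). The recurrence at n says that
    the coefficient of q^n in A(q) psi(-q) vanishes. The identity of Gauss
      psi(q) = prod_s (1 - q^(2s)) / (1 - q^(2s-1)),
    taken at -q, gives
      psi(-q) prod_s (1 + q^(2s-1)) = prod_s (1 - q^(2s)).
    Let U(q) = P(q) prod_s (1 + q^(2s-1)), in which the factors 1 - q^(2s-1)
    of P pair up with the 1 + q^(2s-1), so that U is a series in q^2 as well.
    Then (A psi(-q)) U = (A P) prod_s (1 - q^(2s)) is a series in q^2, and so
    is A psi(-q), as U has constant term 1 and is invertible.

    All series are replaced by polynomials that agree with them up to degree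
    2n: parts are bounded by 2n, and the identity of Gauss is used in the
    finite form of D. Shanks, whose proof is a telescoping sum
    ([shanks_identity], [gauss_truncated]). The division by U up to a given
    degree is [odd_coef_eq0]. *)

(** * Triangular numbers *)

Lemma triangularS (j : nat) : triangular j.+1 = (triangular j + j.+1)%N.
Proof.
rewrite /triangular (_ : j.+1 * _ = j.+1 * 2 + j * (j + 1))%N; last by lia.
by rewrite divnMDl // addnC.
Qed.

Lemma triangular_double (n : nat) : triangular n.*2 = (n * n.*2.+1)%N.
Proof.
rewrite /triangular (_ : n.*2 * _ = (n * n.*2.+1) * 2)%N ?mulnK //; lia.
Qed.

Lemma leq_triangular (j : nat) : (j <= triangular j)%N.
Proof. by case: j => // j; rewrite triangularS leq_addl. Qed.

(** * The finite form of the identity of Gauss *)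

Section FiniteGauss.
Variables (R : comNzRingType) (q : R).

Let oddp n : R := \prod_(0 <= i < n) (1 - q ^+ i.*2.+1).
Let evenp m n : R := \prod_(m <= i < n) (1 - q ^+ i.*2.+2).

(** Without its last factor, the summand is the term of index s in
    [shanks_identity] at n; that factor compares it with the term of the same
    index at n + 1. *)
Lemma shanks_telescope (n : nat) :
  \sum_(0 <= s < n) evenp s n * oddp s * q ^+ (s * n.*2.+1)
      * ((1 - q ^+ n.*2.+2) * q ^+ s.*2 - (1 - q ^+ n.*2.+1))
  = oddp n * (1 - q ^+ n.*2) * q ^+ (n * n.*2.+1).
Proof.
pose g s := evenp s n * oddp s * (1 - q ^+ s.*2) * q ^+ (s * n.*2.+1).
rewrite (eq_big_nat _ _ (F2 := fun s => g s.+1 - g s)); last first.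
  move=> s /andP[_ lt_sn]; rewrite /g /oddp big_nat_recr //= -/(oddp s).
  rewrite [evenp s n]/evenp big_ltn // -/(evenp s.+1 n).
  rewrite mulSn exprD doubleS !exprS.
  by move: (evenp _ _) (oddp _) (q ^+ _) (q ^+ _) (q ^+ _) => *; ring.
rewrite telescope_sumr // /g expr0 subrr mulr0 mul0r subr0.
by rewrite /evenp big_geq // mul1r.
Qed.

(** Shanks' identity, multiplied by the product of the 1 - q^(2i+1) so that no
    division occurs. Passing from n to n + 1 adds the two powers of exponents
    n (2n + 1) and (n + 1) (2n + 1) on the left; on the right, the old terms
    change by the telescoping sum above. *)
Lemma shanks_identity (n : nat) :
  oddp n * \sum_(0 <= j < n.*2) q ^+ triangular j
  = \sum_(0 <= s < n) evenp s n * oddp s * q ^+ (s * n.*2.+1).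
Proof.
elim: n => [|n IHn]; first by rewrite !big_geq ?mulr0.
have step : \sum_(0 <= s < n) evenp s n.+1 * oddp s * q ^+ (s * n.+1.*2.+1)
    = (1 - q ^+ n.*2.+1)
        * (\sum_(0 <= s < n) evenp s n * oddp s * q ^+ (s * n.*2.+1))
      + oddp n * (1 - q ^+ n.*2) * q ^+ (n * n.*2.+1).
  rewrite -shanks_telescope mulr_sumr -big_split /=.
  apply: eq_big_nat => s /andP[_ lt_sn].
  rewrite [evenp s n.+1]/evenp big_nat_recr 1?ltnW //= -/(evenp s n).
  rewrite (_ : s * n.+1.*2.+1 = s * n.*2.+1 + s.*2)%N ?exprD; last by lia.
  by move: (evenp _ _) (oddp _) (q ^+ _) (q ^+ _) (q ^+ _) => *; ring.
rewrite [RHS]big_nat_recr //= {}step -IHn doubleS !big_nat_recr //=.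
rewrite triangularS triangular_double.
rewrite [oddp n.+1]/oddp big_nat_recr //= -/(oddp n).
rewrite [evenp n _]/evenp big_nat1.
rewrite (_ : n * n.+1.*2.+1 = n * n.*2.+1 + n.*2)%N ?exprD; last by lia.
rewrite !exprS.
by move: (\sum_(_ <= _ < _) _) (oddp _) (q ^+ _) (q ^+ _) => *; ring.
Qed.

(** In Shanks' identity the term s = 0 is the product of the 1 - q^(2i+2), and
    every later term is a multiple of q^(2n+1). *)
Lemma gauss_truncated (n : nat) : (0 < n)%N ->
  exists r, oddp n * \sum_(0 <= j < n.*2) q ^+ triangular j
            = evenp 0 n + q ^+ n.*2.+1 * r.
Proof.
case: n => // n _; rewrite shanks_identity.
exists (\sum_(1 <= s < n.+1) evenp s n.+1 * oddp s * q ^+ (s.-1 * n.+1.*2.+1)).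
rewrite big_ltn // mul0n expr0 mulr1 [oddp 0]/oddp big_geq // mulr1.
congr (_ + _); rewrite mulr_sumr; apply: eq_big_nat => -[//|s] _ /=.
by rewrite mulSn exprD mulrCA !mulrA.
Qed.
End FiniteGauss.

(** * Polynomials in the square of the indeterminate *)

Section EvenPolynomials.
Variable R : comNzRingType.
Implicit Types p u v r : {poly R}.

Definition only_even_powers p := forall i, odd i -> p`_i = 0.

Lemma only_even_powers1 : only_even_powers 1.
Proof. by case=> // i _; rewrite coef1. Qed.

Lemma only_even_powers0 : only_even_powers 0.
Proof. by move=> i _; rewrite coef0. Qed.

Lemma only_even_powersD p r :
  only_even_powers p -> only_even_powers r -> only_even_powers (p + r).
Proof. by move=> hp hr i hi; rewrite coefD hp ?hr ?addr0. Qed.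

Lemma only_even_powersM p r :
  only_even_powers p -> only_even_powers r -> only_even_powers (p * r).
Proof.
move=> hp hr i hi; rewrite coefM big1 // => -[j /=]; rewrite ltnS => le_ji _.
have [oj | ej] := boolP (odd j); first by rewrite hp ?mul0r.
by rewrite (hr (i - j)%N) ?mulr0 // oddB // hi (negbTE ej).
Qed.

Lemma only_even_powers_sum (I : Type) (s : seq I) (P : pred I) F :
  (forall i, P i -> only_even_powers (F i)) ->
  only_even_powers (\sum_(i <- s | P i) F i).
Proof. exact: (big_ind _ only_even_powers0 only_even_powersD). Qed.

Lemma only_even_powers_prod (I : Type) (s : seq I) (P : pred I) F :
  (forall i, P i -> only_even_powers (F i)) ->
  only_even_powers (\prod_(i <- s | P i) F i).
Proof. exact: (big_ind _ only_even_powers1 only_even_powersM). Qed.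

Lemma only_even_powersZXn c e : ~~ odd e -> only_even_powers (c *: 'X^e).
Proof.
move=> he i; rewrite coefZ coefXn; case: eqP => [->|]; last by rewrite mulr0.
by rewrite (negbTE he).
Qed.

Lemma only_even_powers_1subXn e : ~~ odd e -> only_even_powers (1 - 'X^e).
Proof.
move=> he; apply: only_even_powersD; first exact: only_even_powers1.
by rewrite -scaleN1r; apply: only_even_powersZXn.
Qed.

(** Truncated division by a unit: modulo 'X^N, the quotient h = v / u of two
    series in 'X^2 is again one. By induction on odd m, since u has constant
    term 1 and no odd coefficient, the coefficient of index m of h * u reduces
    to that of h. *)
Lemma odd_coef_eq0 (h u v r : {poly R}) (N m : nat) :
    only_even_powers u -> only_even_powers v -> u`_0 = 1 ->
    h * u = v + 'X^N * r -> odd m -> (m < N)%N ->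
  h`_m = 0.
Proof.
move=> hu hv u0 huv; elim/ltn_ind: m => m IHm om lt_mN.
have := congr1 (fun p => p`_m) huv.
rewrite /= coefD hv // coefXnM lt_mN addr0 coefM big_ord_recr /= subnn u0 mulr1.
rewrite big1 ?add0r // => -[j /= lt_jm] _.
have [oj | ej] := boolP (odd j).
  by rewrite IHm ?mul0r //; apply: ltn_trans lt_mN.
by rewrite (hu (m - j)%N) ?mulr0 // oddB 1?ltnW // om (negbTE ej).
Qed.
End EvenPolynomials.

(** * The generating function of the parts divisible by k *)

(** Bounding the parts by N keeps this a polynomial; the bound affects only
    the coefficients of degree more than N. *)
Definition parts_gf (k N : nat) : {poly int} :=
  \sum_(m : {ffun 'I_N -> 'I_k})
    (\sum_(i < N | k %| i.+1) m i)%N%:R *: 'X^(\sum_(i < N) m i * i.+1)%N.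

(** A partition of r has neither parts nor multiplicities above r, so parts may
    be allowed up to any r + d, and multiplicities bounded by k alone. This
    gives an index type independent of r, as a generating function requires.
    The bijection restricts a multiplicity function to the parts at most r,
    and extends it back by 0. *)
Lemma a_nat_widen (k r d : nat) : (0 < k)%N ->
  a_nat k r = (\sum_(m : {ffun 'I_(r + d) -> 'I_k} |
                     \sum_(i < r + d) m i * i.+1 == r)
                 \sum_(i < r + d | k %| i.+1) m i)%N.
Proof.
case: k => // k _.
pose h (m : {ffun 'I_(r + d) -> 'I_k.+1}) : {ffun 'I_r -> 'I_r.+1} :=
  [ffun i => inord (m (lshift d i))].
pose g (m : {ffun 'I_r -> 'I_r.+1}) : {ffun 'I_(r + d) -> 'I_k.+1} :=
  [ffun i => match split i with inl i' => inord (m i') | inr _ => ord0 end].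
have sumE (m : {ffun 'I_(r + d) -> 'I_k.+1}) (P : pred nat) (w : nat -> nat) :
    (forall i, m (rshift r i) = 0 :> nat) ->
    (forall i, h m i = m (lshift d i) :> nat) ->
    (\sum_(i < r | P i) h m i * w i = \sum_(i < r + d | P i) m i * w i)%N.
  move=> m0 hE; rewrite big_split_ord /= [X in (_ + X)%N]big1 ?addn0.
    by apply: eq_bigr => i _; rewrite hE.
  by move=> i _; rewrite m0.
have partsE (m : {ffun 'I_(r + d) -> 'I_k.+1}) :
    (forall i, m (rshift r i) = 0 :> nat) ->
    (forall i, h m i = m (lshift d i) :> nat) ->
    num_parts_dvd k.+1 (h m) = (\sum_(i < r + d | k.+1 %| i.+1) m i)%N.
  move=> m0 hE; have := sumE m (fun i => k.+1 %| i.+1)%N (fun=> 1)%N m0 hE.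
  by rewrite /num_parts_dvd; under eq_bigr do rewrite muln1;
     under [RHS]eq_bigr do rewrite muln1.
have small (m : {ffun 'I_(r + d) -> 'I_k.+1}) :
    (\sum_(i < r + d) m i * i.+1 == r)%N ->
    (forall i, m (rshift r i) = 0 :> nat) /\
    (forall i, h m i = m (lshift d i) :> nat).
  move=> /eqP sum_m.
  have le_r i : (m i * i.+1 <= r)%N.
    by apply: leq_trans (eq_leq sum_m); rewrite (bigD1 i) //= leq_addr.
  split=> i; first by have /= := le_r (rshift r i); nia.
  rewrite ffunE inordK // ltnS; have := le_r (lshift d i); nia.
have back (m : {ffun 'I_(r + d) -> 'I_k.+1}) :
    mult_lt k.+1 (h m) -> g (h m) = m ->
    (forall i, m (rshift r i) = 0 :> nat) /\
    (forall i, h m i = m (lshift d i) :> nat).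
  move=> /forallP lt_k ghm; split=> i.
    by rewrite -ghm ffunE (unsplitK (inr i)).
  by rewrite -[in RHS]ghm [in RHS]ffunE (unsplitK (inl i)) inordK.
rewrite /a_nat (reindex_onto h g) => [|m /andP[_ /forallP lt_k]]; last first.
  apply/ffunP=> i; rewrite ffunE; apply: val_inj.
  by rewrite ffunE (unsplitK (inl i)) /= !inordK.
apply: eq_big => [m|m /andP[/andP[_ lt_k] /eqP ghm]]; last first.
  by have [m0 hE] := back m lt_k ghm; apply: partsE.
apply/andP/idP => [[/andP[sum_hm lt_k] /eqP ghm]|sum_m].
  have [m0 hE] := back m lt_k ghm.
  by rewrite -(sumE m xpredT S m0 hE).
have [m0 hE] := small m sum_m; split.
  rewrite /is_partition (sumE m xpredT S m0 hE) sum_m /=.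
  by apply/forallP=> i; rewrite hE.
apply/eqP/ffunP=> i; apply: val_inj; rewrite ffunE.
case: (split_ordP i) => j -> /=; last by rewrite m0.
by rewrite hE inord_val.
Qed.

Lemma coef_parts_gf (k N r : nat) : (0 < k)%N -> (r <= N)%N ->
  (parts_gf k N)`_r = (a_nat k r)%:Z.
Proof.
move=> k_gt0 /subnKC <-; rewrite (a_nat_widen r (N - r) k_gt0) /parts_gf.
rewrite coef_sum -[Posz _]natz natr_sum [RHS]big_mkcond.
apply: eq_bigr => m _; rewrite coefZ coefXn eq_sym.
by case: ifP; rewrite ?mulr1 ?mulr0.
Qed.

(** Exchanging the sums over partitions and over the marked part i leaves, for
    each i, a product over the parts i' of independent choices of their
    multiplicity j; only the factor of the marked part is weighted by j. *)
Lemma parts_gf_prod (k N : nat) :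
  parts_gf k N = \sum_(i < N | (k %| i.+1)%N) \prod_(i' < N) \sum_(j < k)
     (if i' == i then (j : nat)%:R else 1) *: 'X^(j * i'.+1).
Proof.
under eq_bigr do rewrite bigA_distr_bigA /=.
rewrite exchange_big /=; apply: eq_bigr => m _.
rewrite natr_sum scaler_suml; apply: eq_bigr => i _.
rewrite scaler_prod -big_mkcond big_pred1_eq; congr (_ *: _).
by rewrite -prodrXr.
Qed.

(** Each factor 1 - 'X^(i'+1) meets the geometric sum of the part i'+1 and turns
    it into 1 - 'X^(k(i'+1)). The marked part gives no such cancellation, but
    it is a multiple of k, hence even, so its factor has only even powers. *)
Lemma parts_gf_even (k N : nat) : ~~ odd k ->
  only_even_powers (parts_gf k N * \prod_(0 <= i < N) (1 - 'X^(i.+1))).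
Proof.
move=> ek; rewrite parts_gf_prod mulr_suml big_mkord.
apply: only_even_powers_sum => i k_i; rewrite -big_split /=.
apply: only_even_powers_prod => i' _; case: eqP => [->|_].
  have ei : ~~ odd i.+1 by apply: contra ek => oi; apply: dvdn_odd oi.
  apply: only_even_powersM; last exact: only_even_powers_1subXn.
  apply: only_even_powers_sum => j _; apply: only_even_powersZXn.
  by rewrite oddM negb_and ei orbT.
under eq_bigr do rewrite scale1r mulnC exprM.
rewrite mulrC -opprB mulNr -subrX1 opprB -exprM; apply: only_even_powers_1subXn.
by rewrite oddM negb_and ek orbT.
Qed.

(** The odd-index factors pair up into 1 - 'X^(4i+2). *)
Lemma only_even_powers_euler_odd_prod (R : comNzRingType) (n : nat) :
  only_even_powers (\prod_(0 <= i < n.*2) (1 - 'X^(i.+1))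
                    * \prod_(0 <= i < n) (1 - (- 'X) ^+ i.*2.+1) : {poly R}).
Proof.
elim: n => [|n IHn].
  by rewrite !big_geq // mulr1; apply: only_even_powers1.
rewrite doubleS !big_nat_recr //= exprNn -signr_odd /= odd_double expr1 mulN1r.
move: (\prod_(0 <= i < n.*2) _) (\prod_(0 <= i < n) _) IHn => A B IHn.
rewrite opprK.
rewrite (_ : _ * _ = A * B * ((1 - 'X^(n.*2.+2)) * (1 - 'X^(n.*2.+1.*2)))).
  by do 2?apply: only_even_powersM => //; apply: only_even_powers_1subXn;
    rewrite /= ?odd_double.
rewrite -[n.*2.+1.*2]addnn exprD; move: 'X^_ 'X^_ => x y; ring.
Qed.

(** * The recurrence *)

Lemma a_subr_eq0 (k n t : nat) : (n < t)%N -> a k (n%:Z - t%:Z) = 0.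
Proof.
by move=> lt_nt; rewrite (_ : _ - _ = Negz (t - n.+1)) // NegzE; lia.
Qed.

Unset Implicit Arguments.
Set Strict Implicit.

(* The sum over all j >= 1 is cut at j = n: for j > n the argument           *)
(* n - triangular j is negative, so a vanishes there.                        *)
Theorem theorem6p2 (k n : nat) (hk : (2 <= k)%N) (hk_even : ~~ odd k)
    (hn : (1 <= n)%N) (hn_odd : odd n) :
  a k n%:Z = \sum_(1 <= j < n.+1)
    (-1) ^+ (triangular j + 1)%N * a k (n%:Z - (triangular j)%:Z).
Proof.
have k_gt0 : (0 < k)%N by apply: ltnW.
pose q : {poly int} := - 'X; set F := parts_gf k n.*2.
have aE j : (F * q ^+ triangular j)`_n
    = (-1) ^+ triangular j * a k (n%:Z - (triangular j)%:Z).
  rewrite /q (exprNn 'X) mulrCA (_ : (-1) ^+ _ = ((-1) ^+ triangular j)%:P);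
    last by rewrite rmorphXn rmorphN1.
  rewrite coefCM coefMXn; congr (_ * _).
  case: ltnP => [lt_n|le_n]; last first.
    by rewrite subzn // coef_parts_gf // -addnn; lia.
  by rewrite a_subr_eq0.
(* The truncated Gauss identity leaves a multiple of q^(2n+1), which is
   - 'X^(2n+1): whence the sign of the remainder in the division below. *)
have [r gauss] := gauss_truncated q hn.
have : (F * \sum_(0 <= j < n.*2) q ^+ triangular j)`_n = 0.
  apply: (odd_coef_eq0 (only_even_powers_euler_odd_prod _ n)
    (N := n.*2.+1) (r := - (F * \prod_(0 <= i < n.*2) (1 - 'X^(i.+1)) * r))
    (v := F * \prod_(0 <= i < n.*2) (1 - 'X^(i.+1))
          * \prod_(0 <= i < n) (1 - q ^+ i.*2.+2))); rewrite // -/q.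
  - apply: only_even_powersM; first exact: parts_gf_even.
    apply: only_even_powers_prod => i _.
    rewrite exprNn -signr_odd /= odd_double mul1r.
    by apply: only_even_powers_1subXn; rewrite /= odd_double.
  - rewrite -horner_coef0 hornerM !horner_prod !big1 ?mulr1 // => i _.
      by rewrite !hornerE expr0n subr0.
    by rewrite !hornerE expr0n subr0.
  - set P := \prod_(0 <= i < n.*2) _; set D := \prod_(0 <= i < n) _.
    rewrite mulrACA [X in _ * X]mulrC gauss mulrDr.
    rewrite exprNn -signr_odd /= odd_double.
    by rewrite expr1 mulN1r; congr (_ + _); rewrite mulNr !mulrN mulrCA.
  - lia.
rewrite mulr_sumr coef_sum; under eq_bigr do rewrite aE.
rewrite (big_cat_nat _ (n := n.+1)) //=; last by lia.
rewrite [X in _ + X]big1_seq ?addr0.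
  rewrite big_ltn // expr0 mul1r subr0 => /eqP.
  rewrite addr_eq0 => /eqP first_term; apply: etrans first_term _.
  rewrite -sumrN; apply: eq_bigr => j _.
  by rewrite exprD expr1 mulrN1 mulNr.
move=> j; rewrite mem_index_iota => /andP[_ /andP[lt_nj _]].
by rewrite a_subr_eq0 ?mulr0 // (leq_trans lt_nj) // leq_triangular.
Qed.
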